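(* Let $n\ge 1$ and let $G$ be a subgroup of $S_n$ that is generated by elements $\sigma_1^{r_1},\sigma_2^{r_2},\dots,\sigma_t^{r_t}$, where $\sigma_1,\dots,\sigma_t$ are pairwise disjoint cycles in $S_n$ and $r_1,\dots,r_t$ are integers. Then the quotient poset $B_n/G$ is a symmetric chain order.
   Context: A finite poset $P$ is ranked if it has a minimum element $0_P$ and, for every $x\in P$, all saturated chains from $0_P$ to $x$ have the same length $r(x)$ (number of elements minus one); $r(P)=\max_x r(x)$. In a ranked poset a chain $x_1<x_2<\dots<x_k$ is symmetric if it is saturated (each $x_{i+1}$ covers $x_i$) and $r(x_1)+r(x_k)=r(P)$. A symmetric chain decomposition (SCD) of $P$ is a partition of $P$ into symmetric chains; $P$ is a symmetric chain order (SCO) if it has an SCD. $B_n$ is the Boolean lattice of all subsets of $[n]=\{1,\dots,n\}$ ordered by inclusion. $S_n$ acts on $B_n$ by $\sigma(A)=\{\sigma(a):a\in A\}$. For a subgroup $G\le S_n$, the quotient $B_n/G$ is the set of orbits $[A]=\{\sigma(A):\sigma\in G\}$, $A\in B_n$, ordered by $[A]\le[B]$ iff $X\subseteq Y$ for some $X\in[A]$, $Y\in[B]$; its rank function is $r([A])=|A|$. *)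

(* Defs.v *)
From HB Require Import structures.
From mathcomp Require Import all_boot all_order all_algebra all_fingroup.
Set Implicit Arguments. Unset Strict Implicit. Unset Printing Implicit Defensive.

Section Defs.
Variable n : nat.
Notation Bn := {set 'I_n}.

Definition zpow (s : {perm 'I_n}) (r : int) : {perm 'I_n} :=
  match r with
  | Posz m => (s ^+ m)%g
  | Negz m => ((s ^+ m.+1)^-1)%g
  end.

Definition psupp (s : {perm 'I_n}) : Bn := [set x | s x != x].

Definition is_cycle (s : {perm 'I_n}) : Prop :=
  exists x, s x != x /\ psupp s = porbit s x.

Definition orb (G : {set {perm 'I_n}}) (A : Bn) : {set Bn} :=
  [set (fun x => s x) @: A | s : {perm 'I_n} in G].

Definition QP (G : {set {perm 'I_n}}) : {set {set Bn}} :=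
  [set orb G A | A : Bn].

Definition qle (G : {set {perm 'I_n}}) (X Y : {set Bn}) : bool :=
  [exists A in X, exists B in Y, A \subset B].
Definition qlt G (X Y : {set Bn}) : bool := (X != Y) && qle G X Y.

Definition qcover G (X Y : {set Bn}) : bool :=
  qlt G X Y && [forall Z in QP G, ~~ (qlt G X Z && qlt G Z Y)].

(* rank r([A]) = |A| (computed from any member of the orbit) *)
Definition qrank (X : {set Bn}) : nat := #|odflt set0 [pick A in X]|.

(* a symmetric chain x1 < ... < xk, given as the nonempty list [x1;...;xk];
   r(B_n/G) = n *)
Definition sym_chain G (c : seq {set Bn}) : bool :=
  if c is x :: rest then
    path (qcover G) x rest && (qrank x + qrank (last x rest) == n)
  else false.

Definition quotient_SCO (G : {set {perm 'I_n}}) : Prop :=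
  exists cs : seq (seq {set Bn}),
    [/\ all (sym_chain G) cs,
        forall X, X \in flatten cs -> X \in QP G &
        forall X, X \in QP G -> count_mem X (flatten cs) = 1%N].

End Defs.

(* Main.v *)
(* On one cycle of length m, read a subset as a circular word with opening brackets
   at its elements and closing brackets elsewhere, matched cyclically. A subset A
   with 2|A| <= m leaves a set U of m - 2|A| non-elements unmatched, and
   fill A = A + U, of size m - |A|, has the same matched pairs. Adding to A the
   element p of U with the longest gap to the next element of U creates a new
   matched pair, which is the unique longest one of A + p; so p, and hence A, can
   be recovered from A + p, up to any group of rotations. The resulting partial
   injection on orbits yields chains A0 < A1 < ... < Ak, prolonged symmetrically by
   fill Ak < ... < fill A0. Products of symmetric chain orders with disjoint
   supports, and one trivial factor for the fixed points, give the general case. *)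

Require Import Defs.
From mathcomp Require Import all_boot all_order all_algebra all_fingroup.
From mathcomp Require Import zify.
Set Implicit Arguments. Unset Strict Implicit. Unset Printing Implicit Defensive.
Import Order.TTheory GRing.Theory Num.Theory.

(** * Bracketing a cycle *)

Section Walk.
Local Open Scope ring_scope.
Variables (T : finType) (s : {perm T}) (x0 : T).
Local Notation S := (porbit s x0).
Local Notation m := #|S|.
Implicit Types (A B : {set T}) (x y p : T).

Definition stp A x : int := if x \in A then -1 else 1.
Definition walk A x j : int := \sum_(0 <= i < j) stp A (iter i s x).

Lemma walk0 A x : walk A x 0 = 0.
Proof. by rewrite /walk big_nil. Qed.

Lemma walkS A x j : walk A x j.+1 = walk A x j + stp A (iter j s x).
Proof. by rewrite /walk big_nat_recr. Qed.

Lemma stp_bound A x : -1 <= stp A x <= 1.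
Proof. by rewrite /stp; case: ifP. Qed.

Lemma walkD A x i j : walk A x (i + j) = walk A x i + walk A (iter i s x) j.
Proof.
elim: j => [|j IHj]; first by rewrite addn0 walk0 addr0.
by rewrite addnS !walkS IHj -addrA -iterD [(j + i)%N]addnC.
Qed.

Lemma card_cycle_gt0 : (0 < m)%N.
Proof. by apply/card_gt0P; exists x0; exact: porbit_id. Qed.

Lemma porbit_in y : y \in S -> porbit s y = S.
Proof. by rewrite porbit_sym -eq_porbit_mem => /eqP. Qed.

Lemma iter_in i y : y \in S -> iter i s y \in S.
Proof. by move=> /porbit_in <-; rewrite -permX mem_porbit. Qed.

Lemma iter_period y : y \in S -> iter m s y = y.
Proof. by move=> /porbit_in <-; exact: iter_porbit. Qed.

Lemma sum_cycle (R : nmodType) (F : T -> R) y : y \in S ->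
  \sum_(0 <= i < m) F (iter i s y) = \sum_(z in S) F z.
Proof.
move=> yS.
have -> : \sum_(0 <= i < m) F (iter i s y) = \sum_(z <- traject s y m) F z.
  rewrite (big_nth y) size_traject.
  by apply: eq_big_nat => i /andP[_ ltim]; rewrite nth_traject.
have uT : uniq (traject s y m) by rewrite -(porbit_in yS) uniq_traject_porbit.
rewrite big_uniq //=; apply: eq_bigl => z.
by rewrite -(porbit_in yS) porbit_traject.
Qed.

Lemma iter_inj y i j : y \in S -> (i < m)%N -> (j < m)%N ->
  iter i s y = iter j s y -> i = j.
Proof.
move=> yS ltim ltjm eqij.
have uT : uniq (traject s y m) by rewrite -(porbit_in yS) uniq_traject_porbit.
apply/eqP; rewrite -(nth_uniq y _ _ uT) ?size_traject //.
by rewrite !nth_traject // eqij.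
Qed.

Lemma walk_full A y : A \subset S -> y \in S -> walk A y m = m%:Z - (2 * #|A|)%:Z.
Proof.
move=> sAS yS; rewrite /walk (sum_cycle _ yS) (bigID (mem A)) /=.
have -> : \sum_(z in S | z \in A) stp A z = - #|A|%:Z.
  rewrite (eq_bigl (mem A)); last first.
    by move=> z /=; apply: andb_idl => /(subsetP sAS).
  rewrite (eq_bigr (fun=> -1)) => [|z /= zA]; last by rewrite /stp zA.
  by rewrite sumr_const mulNrn natz.
have -> : \sum_(z in S | z \notin A) stp A z = #|S :\: A|%:Z.
  rewrite (eq_bigl (mem (S :\: A))); last by move=> z; rewrite !inE andbC.
  rewrite (eq_bigr (fun=> 1)) => [|z /setDP[_ /negPf zA]]; last by rewrite /stp zA.
  by rewrite sumr_const natz.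
have := cardsID A S; rewrite (setIidPr sAS); lia.
Qed.

(* The unmatched non-elements: the step at [p] takes the walk to a strict record. *)
Definition free A : {set T} :=
  [set p in S | [forall j : 'I_m, walk A (s p) j < walk A (s p) m]].

Lemma free_sub A : free A \subset S.
Proof. by apply/subsetP => p; rewrite inE => /andP[]. Qed.

Lemma freeP A p : p \in S ->
  reflect (forall j, (j < m)%N -> walk A (s p) j < walk A (s p) m) (p \in free A).
Proof.
move=> pS; rewrite inE pS /=.
by apply: (iffP forallP) => [H j ltjm | H j]; [exact: (H (Ordinal ltjm)) | exact: H].
Qed.

Lemma free_notin A p : p \in free A -> p \notin A.
Proof.
move=> pU; have pS := subsetP (free_sub A) _ pU.
have m_gt0 := card_cycle_gt0.
move/freeP: pU => /(_ pS m.-1); rewrite prednK // => /(_ (leqnn _)).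
rewrite -{2}(prednK m_gt0) walkS -iterSr prednK // iter_period // /stp.
by case: ifP => // _; lia.
Qed.

(** The running maximum of the walk. Its increments single out the elements of [free]. *)
Fixpoint peak A x i : int :=
  if i is i'.+1 then Num.max (peak A x i') (walk A x i) else 0.

Lemma walk_le_peak A x i j : (j <= i)%N -> walk A x j <= peak A x i.
Proof.
elim: i => [|i IHi]; first by rewrite leqn0 => /eqP->; rewrite walk0.
rewrite leq_eqVlt le_max => /predU1P[-> | /IHi-> //]; by rewrite lexx orbT.
Qed.

Lemma peak_attained A x i : exists2 j, (j <= i)%N & peak A x i = walk A x j.
Proof.
elim: i => [|i [j leji IHi]]; first by exists 0; rewrite ?walk0.
rewrite /= maxElt; case: ifP => _; first by exists i.+1.
by exists j; first exact: leqW.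
Qed.

Lemma peak_mono A x i j : (i <= j)%N -> peak A x i <= peak A x j.
Proof.
move=> leij; have [l leli ->] := peak_attained A x i.
by apply: walk_le_peak; exact: leq_trans leij.
Qed.

(* For [p] in [A], the distance from [p] to its closing partner ([m] if it has none). *)
Definition arc A p : nat := find (fun j => 0 <= walk A p j.+1) (iota 0 m).

Lemma arc_before A p j : (j < arc A p)%N -> walk A p j.+1 < 0.
Proof.
move=> ltj; have ltjm : (j < m)%N.
  by apply: leq_trans ltj _; rewrite -[X in (_ <= X)%N](size_iota 0) find_size.
by have := before_find 0 ltj; rewrite nth_iota // add0n ltNge => ->.
Qed.

Lemma arc_le A p j : 0 <= walk A p j.+1 -> (arc A p <= j)%N.
Proof. by rewrite leqNgt => wj; apply/negP => /arc_before; lia. Qed.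

Lemma arc_at A p : (arc A p < m)%N -> 0 <= walk A p (arc A p).+1.
Proof.
move=> ltm; have ha : has (fun j => 0 <= walk A p j.+1) (iota 0 m).
  by rewrite has_find size_iota.
by have := nth_find 0 ha; rewrite nth_iota.
Qed.

Lemma walk_add u A x j : (forall i, (i < j)%N -> iter i s x != u) ->
  walk (u |: A) x j = walk A x j.
Proof.
move=> ne; rewrite /walk; apply: eq_big_nat => i /andP[_ /ne].
by rewrite /stp in_setU1 => /negPf->.
Qed.

(** Within one turn [u] is met only at the first step, which turns from [1] into [-1]. *)
Lemma walk_add_self u A j : u \in S -> u \notin A -> (j < m)%N ->
  walk (u |: A) u j.+1 = walk A u j.+1 - 2.
Proof.
move=> uS uA ltjm; rewrite -add1n !walkD (@walk_add u _ (iter 1 s u)); last first.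
  move=> i ltij; apply/eqP; rewrite -iterD addn1 => /(@iter_inj u i.+1 0 uS).
  by have := card_cycle_gt0; lia.
by rewrite !walkS !walk0 /stp /= setU11 (negPf uA); lia.
Qed.

(** * Unmatched elements of a set filling at most half of the cycle *)

Section Balanced.
Variable A : {set T}.
Hypotheses (sAS : A \subset S) (leAm : (2 * #|A| <= m)%N).
Local Notation k := (m%:Z - (2 * #|A|)%:Z).

Lemma walk_shift y i : y \in S -> walk A y (i + m) = walk A y i + k.
Proof. by move=> yS; rewrite addnC walkD iter_period // walk_full // addrC. Qed.

(** [free] compares with one turn back only. As the walk gains [k >= 0] per turn, earlier positions
    are no higher than their later translates, so a record over one turn is a record over the whole
    past. *)
Lemma free_record y i : y \in S -> (m <= i.+1)%N ->
  (iter i s y \in free A) = (peak A y i < walk A y i.+1).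
Proof.
move=> yS lemi; set z := iter (i.+1 - m) s y.
have zS : z \in S by exact: iter_in.
have sz : s (iter i s y) = z.
  by rewrite -iterS -(subnKC lemi) iterD iter_period.
have wE j : walk A y (i.+1 - m + j) = walk A y (i.+1 - m) + walk A z j.
  exact: walkD.
have wi : walk A y i.+1 = walk A y (i.+1 - m) + walk A z m by rewrite -wE subnK.
apply/idP/idP => [/(freeP _ (iter_in _ yS)) | H]; last first.
  apply/(freeP _ (iter_in _ yS)) => j ltjm; rewrite sz.
  have := @walk_le_peak A y i (i.+1 - m + j); rewrite wE; lia.
rewrite sz => H; have {}H d j : (j <= i)%N -> (i - j <= d)%N -> walk A y j < walk A y i.+1.
  elim: d j => [|d IHd] j leji led.
    have jE : j = (i.+1 - m + (j - (i.+1 - m)))%N by have := card_cycle_gt0; lia.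
    rewrite jE wE wi; have := H (j - (i.+1 - m))%N; have := card_cycle_gt0; lia.
  case: (leqP (i.+1 - m) j) => [lej | ltj].
    have jE : j = (i.+1 - m + (j - (i.+1 - m)))%N by lia.
    rewrite jE wE wi; have := H (j - (i.+1 - m))%N; lia.
  have := IHd (j + m)%N; rewrite walk_shift //; have := card_cycle_gt0; lia.
have [j leji ->] := peak_attained A y i.
exact: H leji (leqnn _).
Qed.

(** A step is at most [1], so a record exceeds the previous peak by exactly one. *)
Lemma peakS y i : y \in S -> (m <= i.+1)%N ->
  peak A y i.+1 = peak A y i + (iter i s y \in free A)%:Z.
Proof.
move=> yS lemi; rewrite free_record //= maxElt; case: ifP => // ltp; last by rewrite addr0.
have := @walk_le_peak A y i i (leqnn _).
rewrite walkS in ltp *; have := stp_bound A (iter i s y); lia.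
Qed.

Lemma peak_shift y i : y \in S -> (m <= i.+1)%N -> peak A y (i + m) = peak A y i + k.
Proof.
move=> yS lemi; apply/eqP; rewrite eq_le; apply/andP; split.
  have [j leji ->] := peak_attained A y (i + m).
  case: (leqP m j) => [lemj | ltjm].
    have jE : j = (j - m + m)%N by lia.
    rewrite jE walk_shift //; have := @walk_le_peak A y i (j - m)%N; lia.
  have := @walk_le_peak A y i j; lia.
have [j leji ->] := peak_attained A y i.
rewrite -walk_shift //; apply: walk_le_peak; lia.
Qed.

(** Over one turn the peak gains [k] by [peak_shift], and one for each free element by [peakS]. *)
Lemma card_free : #|free A| = (m - 2 * #|A|)%N.
Proof.
have x0S := porbit_id s x0; have m_gt0 := card_cycle_gt0.
have tele n : peak A x0 (m + n) - peak A x0 m =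
    \sum_(0 <= i < n) (iter i s x0 \in free A)%:Z.
  elim: n => [|n IHn]; first by rewrite addn0 subrr big_nil.
  rewrite big_nat_recr //= -IHn addnS peakS //; last by lia.
  by rewrite addnC iterD iter_period //; lia.
have := tele m; rewrite (@sum_cycle int (fun z => (z \in free A)%:Z)) // peak_shift //.
have -> : \sum_(z in S) (z \in free A)%:Z = #|free A|%:Z.
  rewrite (big_setID (free A)) /= [X in _ + X]big1 => [|z /setDP[_ /negPf->] //].
  rewrite (setIidPr (free_sub A)) addr0 (eq_bigr (fun=> 1)) => [|z -> //].
  by rewrite sumr_const natz.
lia.
Qed.


(** Each free step met turns from [1] into [-1], and the growth of the peak counts these steps. The
    peak is read one turn later, where [peakS] applies. *)
Lemma walk_fill p j : p \in S -> walk (A :|: free A) p j =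
  walk A p j - 2 * (peak A p (m + j) - peak A p m).
Proof.
move=> pS; elim: j => [|j IHj]; first by rewrite !walk0 addn0 subrr mulr0.
rewrite !walkS IHj addnS peakS //; last by lia.
have -> : iter (m + j) s p = iter j s p by rewrite addnC iterD iter_period.
rewrite /stp inE; have := @free_notin A (iter j s p).
case: (_ \in free A) => [/(_ isT)/negPf-> /= | _]; first by lia.
by rewrite orbF /=; lia.
Qed.

(* Pitman's transform: the walk of [A :|: free A] is [walk - 2 peak], from which
   the peak, hence [A], can be recovered. *)
Lemma mem_fill p : p \in A :|: free A ->
  (p \in A) = [exists j : 'I_m, 0 <= walk (A :|: free A) p j.+1].
Proof.
have m_gt0 := card_cycle_gt0 => pB.
have pS : p \in S.
  by move: pB; rewrite inE => /orP[/(subsetP sAS) | /(subsetP (free_sub A))].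
have wm : walk A p m = k by rewrite walk_full.
have wj j : walk A p (m + j) = k + walk A p j.
  by rewrite addnC walk_shift // addrC.
have /= := @walk_le_peak A p m m (leqnn _); rewrite wm => lepm.
apply/idP/existsP => [pA | [[j ltjm] /=]]; last first.
  rewrite walk_fill //; move: pB; rewrite inE orbC.
  (* A free [p] forces [peak A p m = k]. The walk of the filled set is then at most
     [k - peak A p (m + j.+1)], which is negative. *)
  case/orP=> // pU; have := pU; rewrite -{1}(iter_period pS) free_record // -addn1 wj.
  rewrite walkS walk0 add0r /stp (negPf (free_notin pU)) => ltp.
  have := @walk_le_peak A p (m + j.+1) (m + j.+1) (leqnn _); rewrite wj.
  have := @peakS p m pS (leqnSn _); rewrite iter_period // pU.
  have := @peak_mono A p m.+1 (m + j.+1); lia.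
have exj : exists j, (j < m)%N && (0 <= walk A p j.+1).
  exists m.-1; rewrite prednK // leqnn wm; lia.
case: (ex_minnP exj) => j /andP[ltjm w_ge0] minj; exists (Ordinal ltjm) => /=.
have negw i : (i < j)%N -> walk A p i.+1 < 0.
  move=> ltij; rewrite ltNge; apply/negP => wi.
  by have := minj i; rewrite wi (ltn_trans ltij ltjm) => /(_ isT); lia.
have w_le0 i : (i <= j.+1)%N -> walk A p i <= 0.
  case: i => [|i]; first by rewrite walk0.
  rewrite ltnS leq_eqVlt => /predU1P[-> | /negw]; last by lia.
  case: j negw {minj w_ge0 ltjm} => [_|j negw]; first by rewrite walkS walk0 /stp pA.
  rewrite walkS; have := negw j; have := stp_bound A (iter j.+1 s p); lia.
(* Up to its first return the walk stays at or below its start, so no new record occurs and filling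
   alters none of these steps. *)
have pk i : (i <= j.+1)%N -> peak A p (m + i) = peak A p m.
  elim: i => [|i IHi] leij; first by rewrite addn0.
  rewrite addnS /= IHi; last exact: ltnW.
  apply: max_idPl; rewrite -addnS wj; have := w_le0 _ leij; lia.
by rewrite walk_fill // pk // subrr mulr0 subr0.
Qed.

Lemma walk_to_free_gt0 p t : p \in S -> (t < m)%N -> iter t s p \in free A ->
  0 < walk A p t.+1.
Proof.
move=> pS ltm; rewrite -{1}[p](iter_period pS) -iterD free_record //; last by lia.
have := @walk_le_peak A p (t + m) m; rewrite -addSn addnC walkD.
rewrite !(walk_full sAS) ?iter_in //; lia.
Qed.

(* Every matched pair of [p |: A] other than the one opened by [p] lies strictly
   between two consecutive elements of [free A]. *)
Lemma longest_arc p p' : (2 * #|A| + 2 <= m)%N ->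
  p \in free A -> (forall u, u \in free A -> (arc (u |: A) u <= arc (p |: A) p)%N) ->
  p' \in A -> (arc (p |: A) p' < arc (p |: A) p)%N.
Proof.
move=> le2 pU maxp p'A; have m_gt0 := card_cycle_gt0.
have p'S := subsetP sAS _ p'A; have pA := free_notin pU.
have pS := subsetP (free_sub A) _ pU.
(* The largest such [i] is the last record before the walk comes back to [p'] after two turns; [u]
   below is thus the last free element before [p']. *)
have jump : exists i, (i < m + m)%N && (peak A p' i < peak A p' (m + m)).
  exists m; rewrite peak_shift //; lia.
have bound i : (i < m + m)%N && (peak A p' i < peak A p' (m + m)) -> (i <= m + m)%N.
  by case/andP=> /ltnW.
case: (ex_maxnP jump bound) => i /andP[lti ltpk] maxi.
have lemi : (m <= i)%N by apply: maxi; rewrite peak_shift //; lia.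
have pkS : peak A p' i.+1 = peak A p' (m + m).
  apply/eqP; rewrite eq_le peak_mono // leNgt; apply/negP => lt'.
  have ne : (i.+1 < m + m)%N.
    by rewrite ltn_neqAle lti andbT; apply/eqP => eqi; rewrite eqi ltxx in lt'.
  by have := maxi i.+1; rewrite ne lt' ltnn => /(_ isT).
set u := iter i s p'.
have uS : u \in S by exact: iter_in.
have uU : u \in free A.
  by have := @peakS p' i p'S (leqW lemi); rewrite pkS -/u; case: (u \in free A) => //=; lia.
have uA := free_notin uU.
clear jump bound maxi ltpk.
have wi1 : walk A p' i.+1 = peak A p' i.+1.
  have := uU; rewrite /u free_record ?leqW //= => lt_i.
  by rewrite max_r // ltW.
have p'E : iter (m + m) s p' = p' by rewrite iterD !iter_period.
have w2m : walk A p' (m + m) <= walk A p' i.+1.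
  by rewrite wi1 pkS; exact: walk_le_peak.
have wu1 : walk A p' i.+1 = walk A p' i + 1.
  by rewrite walkS /stp (negPf uA).
have {maxp} max_u := maxp u uU; set J := arc (u |: A) u in max_u *.
have ltJm : (J < m)%N.
  rewrite -(prednK m_gt0) ltnS; apply: arc_le.
  by rewrite walk_add_self ?prednK // walk_full //; lia.
(* Inserting [u] lowers its walk by 2, so its arc ends where the walk of [A] gains 2, that is,
   beyond the current peak. This lies past [p'], so the arc of [u] passes over [p']. *)
have wJ : 2 <= walk A u J.+1.
  by have := arc_at ltJm; rewrite -/J walk_add_self //; lia.
have wiJ : walk A p' (i + J.+1) = walk A p' i + walk A u J.+1 by rewrite walkD.
have ltiJ : (m + m < i + J.+1)%N.
  rewrite ltnNge; apply/negP => le'.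
  by have := walk_le_peak A p' le'; rewrite -pkS -wi1; lia.
have w1 : walk A p' 1 = -1 by rewrite walkS walk0 /stp /= p'A.
have [l lE] : exists l, (i + J.+1 = m + m + l.+1)%N.
  by exists (i + J.+1 - (m + m)).-1; lia.
have wle : 1 <= walk A p' l.+1.
  have := walkD A p' (m + m) l.+1; rewrite p'E -lE wiJ; lia.
have {wiJ ltiJ wJ w2m wi1 wu1 pkS} [l' l'E] : exists l', l = l'.+1.
  by case: (l) wle => [|l']; [rewrite w1 | exists l'].
(* The walk from [p'] is positive at the end of the arc of [u], so it is already nonnegative one
   step earlier. *)
have arc_l : (arc A p' <= l')%N.
  apply: arc_le; move: wle; rewrite l'E walkS.
  by have := stp_bound A (iter l'.+1 s p'); lia.
have leJ : (arc A p' < J)%N by clear -lE l'E arc_l lti; lia.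
have ltam : (arc A p' < m)%N by exact: ltn_trans leJ ltJm.
(* It remains that inserting [p] does not lengthen the arc of [p']. Along that arc [p] is not met:
   its step would take the walk above the start, by [walk_to_free_gt0]. *)
apply: leq_trans max_u; apply: leq_trans leJ; rewrite ltnS; apply: arc_le.
rewrite walk_add; first exact: arc_at.
move=> t let_; apply/eqP => tp.
have ltm : (t < m)%N by exact: leq_trans let_ ltam.
have : 0 < walk A p' t.+1 by apply: walk_to_free_gt0; rewrite ?tp.
rewrite ltnS leq_eqVlt in let_; case/predU1P: let_ => [tE | /arc_before]; last first.
  by move=> lt0 gt0; have := lt_trans lt0 gt0; rewrite ltxx.
case: t tE {tp ltm} => [|t] tE; first by rewrite w1.
rewrite walkS; have := @arc_before A p' t; rewrite -tE => /(_ (ltnSn _)).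
by have := stp_bound A (iter t.+1 s p'); clear; lia.
Qed.

End Balanced.

(** * Filling as a bijection between complementary levels, and the apex *)

Lemma free_anti A B : A \subset B -> free B \subset free A.
Proof.
move=> sAB; apply/subsetP => p pU; have pS := subsetP (free_sub B) _ pU.
have stpB z : stp B z <= stp A z.
  rewrite /stp; case: ifP (subsetP sAB z) => _ H; first by case: ifP.
  by case: ifP H => // _ /(_ isT).
move/(freeP _ pS): pU => pU; apply/freeP => // j ltjm; have := pU j ltjm.
(* Enlarging the set lowers every increment, so the final rise to a record for [B] is at least as
   large for [A]. *)
have le d : walk B (s p) (j + d) - walk B (s p) j <= walk A (s p) (j + d) - walk A (s p) j.
  elim: d => [|d IHd]; first by rewrite addn0 !subrr.
  by rewrite addnS !walkS; have := stpB (iter (j + d) s (s p)); lia.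
have := le (m - j)%N; rewrite subnKC 1?ltnW //; lia.
Qed.

Definition fill A := A :|: free A.

Lemma fill_sub A : A \subset S -> fill A \subset S.
Proof. by move=> sAS; rewrite subUset sAS free_sub. Qed.

Lemma card_fill A : A \subset S -> (2 * #|A| <= m)%N -> #|fill A| = (m - #|A|)%N.
Proof.
move=> sAS leA; rewrite cardsU disjoint_setI0 ?cards0 ?card_free //; first by lia.
rewrite disjoint_sym; apply/pred0P => p /=; apply/andP => -[pU pA].
by have := free_notin pU; rewrite pA.
Qed.

(** By [mem_fill], membership in the original set can be read off the filled set alone. *)
Lemma fill_inj A B : A \subset S -> B \subset S -> (2 * #|A| <= m)%N ->
  (2 * #|B| <= m)%N -> fill A = fill B -> A = B.
Proof.
have half (X Y : {set T}) : X \subset S -> Y \subset S -> (2 * #|X| <= m)%N ->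
    (2 * #|Y| <= m)%N -> fill X = fill Y -> X \subset Y.
  move=> sX sY leX leY eqf; apply/subsetP => p pX.
  have pfX : p \in fill X by rewrite inE pX.
  have pfY : p \in fill Y by rewrite -eqf.
  by rewrite (mem_fill sY leY pfY) -/(fill Y) -eqf -mem_fill.
by move=> sA sB leA leB eqf; apply/eqP; rewrite eqEsubset (half A B) ?(half B A).
Qed.

(** Filling is injective between two complementary levels, which have equal size by symmetry of the
    binomial coefficients. *)
Lemma fill_onto B : B \subset S -> (m <= 2 * #|B|)%N ->
  exists A, [/\ A \subset S, #|A| = (m - #|B|)%N & fill A = B].
Proof.
move=> sBS leB; have leBm := subset_leq_card sBS.
pose X r : {set {set T}} := [set A : {set T} | A \subset S & #|A| == r].
have imX : [set fill A | A in X (m - #|B|)%N] = X #|B|.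
  apply/eqP; rewrite eqEcard; apply/andP; split.
    apply/subsetP => _ /imsetP[A + ->]; rewrite !inE => /andP[sA /eqP cA].
    by rewrite fill_sub // card_fill //; lia.
  rewrite card_in_imset ?cards_draws ?bin_sub // => A A'.
  rewrite !inE => /andP[sA /eqP cA] /andP[sA' /eqP cA']; apply: fill_inj => //; lia.
have : B \in X #|B| by rewrite inE sBS eqxx.
by rewrite -imX => /imsetP[A]; rewrite inE => /andP[sA /eqP cA] eB; exists A.
Qed.

(** The strict inequality is what lets [p] be recovered from [p |: A]. *)
Definition apex A p :=
  (p \in free A) && [forall (p' | p' \in A), arc (p |: A) p' < arc (p |: A) p]%N.

Lemma apex_exists A : A \subset S -> (2 * #|A| + 2 <= m)%N -> exists p, apex A p.
Proof.
move=> sAS le2; have leA : (2 * #|A| <= m)%N by lia.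
have /card_gt0P[u uU] : (0 < #|free A|)%N by rewrite card_free //; lia.
case: (arg_maxnP (fun u => arc (u |: A) u) uU) => p pU maxp.
exists p; apply/andP; split=> //; apply/forall_inP => p'.
exact: longest_arc.
Qed.

(** * Equivariance under permutations commuting with the cycle *)

Section Equivariance.
Variable g : {perm T}.
Hypotheses (gs : forall x, g (s x) = s (g x)) (gS : forall x, (g x \in S) = (x \in S)).

Lemma walk_act A x j : walk (g @: A) (g x) j = walk A x j.
Proof.
rewrite /walk; apply: eq_bigr => i _; rewrite /stp.
have -> : iter i s (g x) = g (iter i s x).
  by elim: i => //= i ->; rewrite gs.
by rewrite mem_imset //; exact: perm_inj.
Qed.

Lemma free_act A : free (g @: A) = g @: free A.
Proof.
apply/setP => y; have [z ->] : exists z, y = g z by exists (g^-1%g y); rewrite permKV.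
rewrite mem_imset; last exact: perm_inj.
rewrite !inE gS; congr (_ && _); apply: eq_forallb => j.
by rewrite -gs !walk_act.
Qed.

Lemma fill_act A : fill (g @: A) = g @: fill A.
Proof. by rewrite /fill free_act imsetU. Qed.

Lemma arc_act A p : arc (g @: A) (g p) = arc A p.
Proof. by rewrite /arc; apply: eq_find => j; rewrite walk_act. Qed.

(** Arcs are preserved by [g]. If [g p] were not [p'], the arcs of [g p] and [p'] would each be
    strictly longer than the other. *)
Lemma apex_act A A' p p' : apex A p -> apex A' p' ->
  g @: (p |: A) = p' |: A' -> g @: A = A'.
Proof.
move=> /andP[pU /forall_inP maxp] /andP[p'U /forall_inP maxp'] eqA.
have gp : g p = p'.
  have : g p \in p' |: A' by rewrite -eqA imset_f // setU11.
  rewrite in_setU1 => /predU1P[// | gpA'].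
  have : p' \in g @: (p |: A) by rewrite eqA setU11.
  case/imsetP=> q; rewrite in_setU1 => /predU1P[-> // | qA p'E].
  have := maxp' _ gpA'; rewrite -eqA p'E !arc_act => lt1.
  by rewrite ltnNge ltnW ?maxp in lt1.
have := eqA; rewrite imsetU1 gp => /(congr1 (fun X => X :\ p')).
rewrite !setU1K ?(free_notin p'U) //.
by rewrite -gp mem_imset ?(free_notin pU) //; exact: perm_inj.
Qed.

End Equivariance.
End Walk.

(** * Symmetric chains of orbit representatives *)

Section Orbits.
Variable T : finType.
Implicit Types (G : {group {perm T}}) (A B S : {set T}).

(** The analogue of [orb] over any finite type, convertible to it on ordinals. *)
Definition setorb G A : {set {set T}} := [set g @: A | g : {perm T} in G].

Lemma orbP G A B : reflect (exists2 g, g \in G & B = g @: A) (B \in setorb G A).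
Proof. exact: imsetP. Qed.

Lemma act1 A : (1%g : {perm T}) @: A = A.
Proof. by rewrite -[RHS]imset_id; apply: eq_imset => x; rewrite perm1. Qed.

Lemma actM (g h : {perm T}) A : (g * h)%g @: A = h @: (g @: A).
Proof. by rewrite -imset_comp; apply: eq_imset => x; rewrite permM. Qed.

Lemma card_act (g : {perm T}) A : #|g @: A| = #|A|.
Proof. exact: card_imset perm_inj. Qed.

Lemma orb_refl G A : A \in setorb G A.
Proof. by apply/orbP; exists 1%g; rewrite ?group1 ?act1. Qed.

Lemma orb_sym G A B : (B \in setorb G A) = (A \in setorb G B).
Proof.
have half X Y : Y \in setorb G X -> X \in setorb G Y.
  case/orbP=> g gG ->; apply/orbP; exists g^-1%g; first by rewrite groupV.
  by rewrite -actM mulgV act1.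
by apply/idP/idP; exact: half.
Qed.

Lemma orb_trans G A B C : B \in setorb G A -> C \in setorb G B -> C \in setorb G A.
Proof.
case/orbP=> g gG -> /orbP[h hG ->]; apply/orbP; exists (g * h)%g; first exact: groupM.
by rewrite actM.
Qed.

Lemma orb_eq G A B : (setorb G B == setorb G A) = (B \in setorb G A).
Proof.
apply/eqP/idP => [<- | BA]; first exact: orb_refl.
apply/setP => C; apply/idP/idP; first exact: orb_trans.
by apply: orb_trans; rewrite orb_sym.
Qed.

Lemma card_orb G A B : B \in setorb G A -> #|B| = #|A|.
Proof. by case/orbP=> g _ ->; exact: card_act. Qed.

(** The cover relation of the quotient, read on orbit representatives. *)
Definition step G A B : bool :=
  (#|B| == #|A|.+1) && [exists g in G, g @: A \subset B].

Definition schain G N (c : seq {set T}) : bool :=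
  if c is A :: c' then path (step G) A c' && (#|A| + #|last A c'| == N) else false.

(* A symmetric chain decomposition of the subsets of [S] modulo [G], given by
   orbit representatives. *)
Definition sco_on S G : Prop := exists cs : seq (seq {set T}),
  [/\ all (schain G #|S|) cs,
      forall A, A \in flatten cs -> A \subset S
    & forall A, A \subset S -> count (mem (setorb G A)) (flatten cs) = 1%N].

(** The choice depends on the orbit only, so it is the same for all its members. *)
Definition rep G A : {set T} := odflt set0 [pick B in setorb G A].

Lemma rep_in G A : rep G A \in setorb G A.
Proof. by rewrite /rep; case: pickP => [// | /(_ A)]; rewrite orb_refl. Qed.

Lemma rep_eq G A B : B \in setorb G A -> rep G B = rep G A.
Proof. by rewrite -orb_eq /rep => /eqP->. Qed.

End Orbits.

(** * From orbit representatives to the quotient poset *)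

Section Quotient.
Variables (n : nat) (G : {group {perm 'I_n}}).
Implicit Types A B : {set 'I_n}.

Lemma qrank_orb A : qrank (setorb G A) = #|A|.
Proof.
rewrite /qrank; case: pickP => [B /card_orb // | /(_ A)].
by rewrite orb_refl.
Qed.

Lemma qlt_rank A B : qlt G (setorb G A) (setorb G B) -> #|A| < #|B|.
Proof.
case/andP=> neAB /exists_inP[X XA /exists_inP[Y YB sXY]].
rewrite -(card_orb XA) -(card_orb YB) proper_card // properEneq sXY andbT.
apply: contraNneq neAB => eqXY; rewrite orb_eq; apply: orb_trans YB _.
by rewrite orb_sym -eqXY.
Qed.

(** Rank strictly increases along [qlt], so nothing fits between consecutive ranks. *)
Lemma step_qcover A B : step G A B -> qcover G (setorb G A) (setorb G B).
Proof.
case/andP=> /eqP cB /exists_inP[g gG sgAB]; apply/andP; split.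
  apply/andP; split.
    by apply: contra_eqN cB => /eqP eqAB; rewrite -(qrank_orb B) -eqAB qrank_orb; lia.
  apply/exists_inP; exists (g @: A); first by apply/orbP; exists g.
  by apply/exists_inP; exists B; rewrite ?orb_refl.
apply/forall_inP => _ /imsetP[C _ ->]; apply/negP => /andP[/qlt_rank + /qlt_rank].
by rewrite cB; lia.
Qed.

Lemma sco_on_quotient : sco_on setT G -> quotient_SCO G.
Proof.
case=> cs [scs _ cnt]; exists (map (map (setorb G)) cs); split.
- rewrite all_map; apply: sub_all scs => -[//|A c] /= /andP[pA /eqP rA].
  rewrite last_map !qrank_orb rA cardsT card_ord eqxx andbT path_map.
  by apply: sub_path pA => X Y /=; exact: step_qcover.
- by move=> X; rewrite -map_flatten => /mapP[A _ ->]; exact: imset_f.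
move=> _ /imsetP[A _ ->]; rewrite -map_flatten count_map -(cnt A (subsetT _)).
by apply: eq_count => B /=; rewrite orb_eq.
Qed.

End Quotient.

(** * Symmetric chains on a single cycle *)

Section Cycle.
Variables (T : finType) (s : {perm T}) (x0 : T) (G : {group {perm T}}).
Hypothesis sGs : G \subset <[s]>%g.
Local Notation S := (porbit s x0).
Local Notation m := #|S|.
Local Notation fill := (fill s x0).
Implicit Types (A B X : {set T}).

Lemma cycle_comm g x : g \in G -> g (s x) = s (g x).
Proof.
by case/(subsetP sGs)/cycleP=> i ->; rewrite -!permM -expgS -expgSr.
Qed.

Lemma cycle_stable g x : g \in G -> (g x \in S) = (x \in S).
Proof.
case/(subsetP sGs)/cycleP=> i ->; rewrite ![_ \in S]porbit_sym.
by rewrite porbit_perm.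
Qed.

Lemma cycle_act_sub g A : g \in G -> (g @: A \subset S) = (A \subset S).
Proof.
move=> gG; apply/subsetP/subsetP => sA x.
  by move=> xA; rewrite -(cycle_stable x gG) sA ?imset_f.
by case/imsetP=> y yA ->; rewrite cycle_stable ?sA.
Qed.

Lemma orb_sub A B : B \in setorb G A -> (B \subset S) = (A \subset S).
Proof. by case/orbP=> g gG ->; exact: cycle_act_sub. Qed.

Lemma orb_fill A B : B \in setorb G A -> fill B \in setorb G (fill A).
Proof.
case/orbP=> g gG ->; apply/orbP; exists g => //.
by apply: fill_act => x; [exact: cycle_comm | exact: cycle_stable].
Qed.

Lemma mem_orb_fill A B : A \subset S -> B \subset S -> 2 * #|A| <= m ->
  2 * #|B| <= m -> (fill A \in setorb G (fill B)) = (A \in setorb G B).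
Proof.
move=> sA sB leA leB; apply/idP/idP; last exact: orb_fill.
case/orbP=> g gG; rewrite -(@fill_act _ _ x0 _ (fun x => cycle_comm x gG)) => [|x].
  move=> /fill_inj->; rewrite ?cycle_act_sub ?card_act //.
  by apply/orbP; exists g.
exact: cycle_stable.
Qed.

(* One representative per orbit in the lower half. *)
Definition low : {set {set T}} :=
  [set A : {set T} | [&& A \subset S, rep G A == A & 2 * #|A| <= m]].

(** Those that stay in the lower half after adding an element; there an apex exists. *)
Definition low2 : {set {set T}} := [set A in low | 2 * #|A| + 2 <= m].

Definition raise A : {set T} :=
  if [pick p | apex s x0 A p] is Some p then rep G (p |: A) else A.

Lemma lowP A : reflect [/\ A \subset S, rep G A = A & 2 * #|A| <= m] (A \in low).
Proof. by rewrite inE; apply: (iffP and3P) => -[? /eqP]. Qed.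

Lemma rep_low A : A \subset S -> 2 * #|A| <= m -> rep G A \in low.
Proof.
move=> sAS leA; have rA := rep_in G A; apply/lowP; split.
- by rewrite (orb_sub rA).
- exact: rep_eq.
- by rewrite (card_orb rA).
Qed.

Lemma raiseP A : A \in low2 -> exists2 p, apex s x0 A p & raise A = rep G (p |: A).
Proof.
rewrite inE => /andP[/lowP[sAS _ leA] le2].
have [p0 ap0] := apex_exists sAS le2.
rewrite /raise; case: pickP => [p ap | /(_ p0)]; [by exists p | by rewrite ap0].
Qed.

Lemma apex_sub A p : A \subset S -> apex s x0 A p -> p |: A \subset S.
Proof.
by move=> sAS /andP[pU _]; rewrite subUset sub1set sAS (subsetP (free_sub _ _ _) _ pU).
Qed.

Lemma apex_card A p : apex s x0 A p -> #|p |: A| = #|A|.+1.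
Proof. by case/andP=> pU _; rewrite cardsU1 (free_notin pU). Qed.

Lemma card_raise A : A \in low2 -> #|raise A| = #|A|.+1.
Proof. by case/raiseP=> p ap ->; rewrite (card_orb (rep_in _ _)) (apex_card ap). Qed.

Lemma raise_low A : A \in low2 -> raise A \in low.
Proof.
move=> A2; have [p ap ->] := raiseP A2.
move: A2; rewrite inE => /andP[/lowP[sAS _ _] le2].
apply: rep_low; rewrite ?apex_sub // (apex_card ap); lia.
Qed.

(** If [p |: A] and [q |: B] share an orbit, [apex_act] puts [A] and [B] in one orbit, and [low] has
    one member per orbit. *)
Lemma raise_inj : {in low2 &, injective raise}.
Proof.
move=> A B A2 B2; have [p ap ->] := raiseP A2; have [q bq ->] := raiseP B2.
move=> eqr; have : p |: A \in setorb G (q |: B).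
  by apply: orb_trans (rep_in _ _) _; rewrite -eqr orb_sym rep_in.
case/orbP=> g gG eqg.
have gBA : g @: B = A.
  exact: (apex_act (fun x => cycle_comm x gG) bq ap (esym eqg)).
move: A2 B2; rewrite !inE => /andP[/and3P[_ /eqP <- _] _] /andP[/and3P[_ /eqP <- _] _].
by apply: rep_eq; apply/orbP; exists g.
Qed.

Lemma step_raise A : A \in low2 -> step G A (raise A).
Proof.
move=> A2; rewrite /step card_raise // eqxx; have [p _ ->] := raiseP A2.
have /orbP[g gG ->] := rep_in G (p |: A).
by apply/exists_inP; exists g => //; rewrite imsetS ?subsetUr.
Qed.

Lemma fill_apex_sub A p : p \in free s x0 A -> fill (p |: A) \subset fill A.
Proof.
move=> pU; rewrite !subUset sub1set inE pU orbT subsetUl /=.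
by rewrite subsetU // free_anti ?orbT // subsetUr.
Qed.

(** Filling reverses the order along [raise]: the added [p] is free, hence already in [fill A], and
    [free] is antitone. *)
Lemma step_fill_raise A : A \in low2 -> step G (fill (raise A)) (fill A).
Proof.
move=> A2; have [srS _ ler] := lowP _ (raise_low A2).
have := A2; rewrite inE => /andP[/lowP[sAS _ leA] le2].
rewrite /step !card_fill // card_raise //; apply/andP; split; first by lia.
have [p /andP[pU _] eqr] := raiseP A2.
have := orb_fill (rep_in G (p |: A)); rewrite orb_sym -eqr => /orbP[g gG eqg].
by apply/exists_inP; exists g => //; rewrite -eqg fill_apex_sub.
Qed.

(** Built from the ends inwards, with [d] the height of [A]. At height 0, [A] and [fill A] coincide
    if [m] is even and differ by one in size if [m] is odd. *)
Fixpoint chain d A : seq {set T} :=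
  if d is d'.+1 then A :: rcons (chain d' (raise A)) (fill A)
  else if 2 * #|A| == m then [:: A] else [:: A; fill A].

Definition height A := m./2 - #|A|.

Lemma height_low2 A : A \in low -> (A \in low2) = (0 < height A).
Proof. by move=> Alow; rewrite inE Alow /height; case/lowP: Alow; lia. Qed.

Lemma height_raise A : A \in low2 -> height A = (height (raise A)).+1.
Proof.
by move=> A2; rewrite /height card_raise //; move: A2; rewrite inE => /andP[_]; lia.
Qed.

Lemma chain_path d A : A \in low -> height A = d -> exists c,
  [/\ chain d A = A :: c, path (step G) A c & last A c = fill A].
Proof.
elim: d A => [|d IHd] A Alow hA; have [sAS rA leA] := lowP _ Alow.
  have cf := card_fill sAS leA; rewrite /=; case: eqP => eqA.
    exists [::]; split=> //=; apply/eqP; rewrite eqEcard subsetUl /= cf; lia.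
  exists [:: fill A]; split=> //=; rewrite andbT /step cf.
  apply/andP; split; first by move: hA eqA; rewrite /height; lia.
  by apply/exists_inP; exists 1%g; rewrite ?group1 ?act1 ?subsetUl.
have A2 : A \in low2 by rewrite height_low2 // hA.
have [|c [eqc pc lc]] := IHd _ (raise_low A2).
  by move: hA; rewrite height_raise // => -[].
exists (raise A :: rcons c (fill A)); rewrite /= eqc last_rcons; split=> //.
by rewrite step_raise // rcons_path pc lc step_fill_raise.
Qed.

Lemma chain_sub d A : A \in low -> height A = d ->
  forall B, B \in chain d A -> B \subset S.
Proof.
elim: d A => [|d IHd] A Alow hA B /=; have [sAS _ _] := lowP _ Alow.
  by case: ifP => _; rewrite !inE; [move/eqP-> | case/orP=> /eqP->; rewrite ?fill_sub].
have A2 : A \in low2 by rewrite height_low2 // hA.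
rewrite inE mem_rcons inE => /or3P[/eqP-> // | /eqP-> | ]; first exact: fill_sub.
by apply: IHd; [exact: raise_low | move: hA; rewrite height_raise // => -[]].
Qed.

(** The factor [2 * #|A| != m] keeps a middle set, equal to its own filling, from counting twice. *)
Lemma chain_count (P : pred {set T}) A : A \in low ->
  count P (chain (height A) A) = P A + (2 * #|A| != m) * P (fill A) +
    (A \in low2) * count P (chain (height (raise A)) (raise A)).
Proof.
move=> Alow; rewrite height_low2 //; case hA: (height A) => [|d] /=.
  by case: eqP; rewrite /=; lia.
have A2 : A \in low2 by rewrite height_low2 // hA.
rewrite -cats1 count_cat /= addn0.
have -> : height (raise A) = d by move: hA; rewrite height_raise // => -[].
have -> : 2 * #|A| != m by move: A2; rewrite inE => /andP[_]; lia.
lia.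
Qed.

(* Telescoping [chain_count] along [raise], which is injective on [low2]. *)
Lemma chains_count (P : pred {set T}) :
  count P (flatten [seq chain (height A) A | A <- enum (low :\: raise @: low2)]) =
  \sum_(A in low) (P A + (2 * #|A| != m) * P (fill A)).
Proof.
pose F A := count P (chain (height A) A).
have -> : count P (flatten [seq chain (height A) A | A <- enum (low :\: raise @: low2)])
    = \sum_(A in low :\: raise @: low2) F A.
  by rewrite count_flatten sumnE -map_comp big_map big_enum.
have sRL : raise @: low2 \subset low.
  by apply/subsetP => _ /imsetP[A A2 ->]; exact: raise_low.
have sLL : low2 \subset low by apply/subsetP => A; rewrite inE => /andP[].
have E : \sum_(A in low) F A =
    \sum_(A in low) (P A + (2 * #|A| != m) * P (fill A)) + \sum_(A in low2) F (raise A).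
  rewrite (eq_bigr _ (fun A => @chain_count P A)) big_split /=; congr (_ + _).
  rewrite (big_setID low2) /= (setIidPr sLL) [X in _ + X]big1 => [|A]; last first.
    by case/setDP=> _ /negPf->.
  by rewrite addn0; apply: eq_bigr => A ->; rewrite mul1n.
(* By injectivity both sides contain the sum of [F] over the image of [raise], which cancels. *)
move: E; rewrite (big_setID (raise @: low2)) /= (setIidPr sRL).
by rewrite (big_imset _ raise_inj) /= addnC => /addIn.
Qed.

Lemma sco_on_cycle : sco_on S G.
Proof.
(* Chains start at the representatives that are not themselves raised from a smaller one. *)
exists [seq chain (height A) A | A <- enum (low :\: raise @: low2)].
have lowD A : A \in enum (low :\: raise @: low2) -> A \in low.
  by rewrite mem_enum => /setDP[].
split.
- apply/allP => _ /mapP[A /lowD Alow ->].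
  have [c [-> pc lc]] := chain_path Alow erefl; have [sAS _ leA] := lowP _ Alow.
  rewrite /= pc lc card_fill //; lia.
- by move=> B /flatten_mapP[A /lowD Alow]; exact: chain_sub Alow erefl _.
move=> X sXS; rewrite chains_count.
have sum_rep (Y : {set T}) : Y \subset S -> 2 * #|Y| <= m ->
    \sum_(A in low) (A \in setorb G Y : nat) = 1.
  move=> sY leY; rewrite (bigD1 (rep G Y)) ?rep_low //= rep_in big1 // => A.
  case/andP=> /lowP[_ rA _]; apply: contraNeq; rewrite eqb0 negbK.
  by move=> /rep_eq; rewrite rA => ->.
case: (leqP (2 * #|X|) m) => leX.
  (* In the lower half only the unfilled terms count: [fill A] of the size of [X] would force
     [2 * #|A| = m]. *)
  rewrite -[RHS](sum_rep X sXS leX); apply: eq_bigr => A /lowP[sAS _ leA] /=.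
  case: eqP => [_ | ne]; first by rewrite addn0.
  case: (boolP (fill A \in _)) => [/card_orb | _]; last by rewrite addn0.
  by rewrite card_fill //; lia.
(* In the upper half [X] is a filling, and its orbit is met exactly when that of [Y] is. *)
have [Y [sYS cY <-]] := fill_onto sXS (ltnW leX).
have leXm := subset_leq_card sXS; have leY : 2 * #|Y| <= m by lia.
rewrite -[RHS](sum_rep Y sYS leY); apply: eq_bigr => A /lowP[sAS _ leA] /=.
rewrite mem_orb_fill //; case: (boolP (A \in setorb G (fill Y))) => [/card_orb | _].
  by rewrite card_fill //; lia.
case: (boolP (A \in setorb G Y)) => [/card_orb cA | _]; last by rewrite muln0.
by case: eqP => // eqA; lia.
Qed.

End Cycle.

(** * Products of symmetric chain orders *)

Lemma count_allpairs (I J K : eqType) (f : I -> J -> K) (P : pred K)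
    (P1 : pred I) (P2 : pred J) (s : seq I) (t : seq J) :
  {in s & t, forall x y, P (f x y) = P1 x && P2 y} ->
  count P [seq f x y | x <- s, y <- t] = count P1 s * count P2 t.
Proof.
elim: s => [|x s IHs] Pf //=; rewrite count_cat IHs; last first.
  by move=> y z ys zt; rewrite Pf // inE ys orbT.
rewrite mulnDl; congr (_ + _); rewrite count_map.
rewrite (@eq_in_count _ _ [pred y | P1 x && P2 y]) => [|y yt /=]; last first.
  by rewrite Pf // inE eqxx.
by case: (P1 x); rewrite ?mul1n ?mul0n //= count_pred0.
Qed.

Lemma perm_allpairs_rcons (I J : Type) (K : eqType) (f : I -> J -> K) s t y :
  perm_eq [seq f x z | x <- s, z <- rcons t y]
    ([seq f x y | x <- s] ++ [seq f x z | x <- s, z <- t]).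
Proof.
rewrite -cats1 perm_sym perm_catC perm_sym.
apply: perm_trans (permEl (perm_allpairs_catr f s (fun=> t) (fun=> [:: y]))) _.
rewrite perm_cat2l; apply: perm_trans (permEl (perm_allpairs_consr _ _ _ (fun=> [::]))) _.
by rewrite allpairs0r cats0.
Qed.

Section Product.
Variables (T : finType) (S1 S2 : {set T}) (G1 G2 : {group {perm T}}).
Hypotheses (dS : [disjoint S1 & S2]) (sG1 : G1 \subset Sym S1) (sG2 : G2 \subset Sym S2).
Local Notation G := (G1 <*> G2)%G.
Implicit Types (A B X Y Z : {set T}) (c : seq {set T}).

Lemma act_Sym_sub (S A : {set T}) g : g \in Sym S -> A \subset S -> g @: A \subset S.
Proof.
rewrite inE => gS sAS; apply/subsetP => _ /imsetP[x xA ->].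
by rewrite perm_closed // (subsetP sAS).
Qed.

Lemma act_Sym_disjoint (S A : {set T}) g : g \in Sym S -> [disjoint S & A] -> g @: A = A.
Proof.
rewrite inE => gS dSA; rewrite -[RHS]imset_id; apply: eq_in_imset => x xA.
by apply: (out_perm gS); apply: contraL xA; move/(disjointFr dSA) => ->.
Qed.

Lemma product_act g1 g2 A1 A2 : g1 \in G1 -> g2 \in G2 -> A1 \subset S1 -> A2 \subset S2 ->
  (g1 * g2)%g @: (A1 :|: A2) = (g1 @: A1) :|: (g2 @: A2).
Proof.
move=> /(subsetP sG1) g1S /(subsetP sG2) g2S sA1 sA2; rewrite actM !imsetU.
rewrite [g1 @: A2](act_Sym_disjoint g1S) ?(disjointWr sA2) //.
rewrite [g2 @: (g1 @: A1)](act_Sym_disjoint g2S) // disjoint_sym.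
by rewrite (disjointWl (act_Sym_sub g1S sA1)).
Qed.

Lemma product_group : (G1 <*> G2 = G1 * G2)%g.
Proof.
rewrite cent_joinEr //; apply/centsP => g gG2 h hG1.
have := subsetP sG2 _ gG2; have := subsetP sG1 _ hG1; rewrite !inE => hS gS.
by apply: (perm_onC gS hS); rewrite disjoint_sym.
Qed.

Lemma disjoint_setU_inj A1 A2 B1 B2 : A1 \subset S1 -> A2 \subset S2 ->
  B1 \subset S1 -> B2 \subset S2 -> A1 :|: A2 = B1 :|: B2 -> A1 = B1 /\ A2 = B2.
Proof.
move=> sA1 sA2 sB1 sB2 eqU.
have part1 X1 X2 : X1 \subset S1 -> X2 \subset S2 -> (X1 :|: X2) :&: S1 = X1.
  move=> s1 s2; rewrite setIUl (setIidPl s1).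
  by rewrite [X2 :&: _]disjoint_setI0 ?setU0 // disjoint_sym (disjointWr s2).
have part2 X1 X2 : X1 \subset S1 -> X2 \subset S2 -> (X1 :|: X2) :&: S2 = X2.
  move=> s1 s2; rewrite setIUl (setIidPl s2).
  by rewrite [X1 :&: _]disjoint_setI0 ?set0U // (disjointWl s1).
by rewrite -(part1 A1 A2) // -{2}(part2 A1 A2) // eqU part1 // part2.
Qed.

(** The join is the product [G1 * G2], and each factor acts on its own part only. *)
Lemma product_orb X Y A1 A2 : X \subset S1 -> Y \subset S2 -> A1 \subset S1 ->
  A2 \subset S2 ->
  (X :|: Y \in setorb G (A1 :|: A2)) = (X \in setorb G1 A1) && (Y \in setorb G2 A2).
Proof.
move=> sX sY sA1 sA2; apply/orbP/andP => [[g]|[/orbP[g1 g1G ->] /orbP[g2 g2G ->]]].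
  rewrite /= product_group => /mulsgP[g1 g2 g1G g2G ->].
  rewrite product_act // => /disjoint_setU_inj[] //.
  - exact: act_Sym_sub (subsetP sG1 _ g1G) _.
  - exact: act_Sym_sub (subsetP sG2 _ g2G) _.
  by move=> -> ->; split; apply/orbP; [exists g1 | exists g2].
exists (g1 * g2)%g; first by rewrite /= product_group mem_mulg.
by rewrite product_act.
Qed.

Lemma card_setU_disjoint A1 A2 : A1 \subset S1 -> A2 \subset S2 ->
  #|A1 :|: A2| = #|A1| + #|A2|.
Proof.
move=> s1 s2; rewrite cardsU disjoint_setI0 ?cards0 ?subn0 //.
by rewrite (disjointWl s1) // (disjointWr s2).
Qed.

Lemma step_setUl X Y Z : X \subset S1 -> Y \subset S1 -> Z \subset S2 ->
  step G1 X Y -> step G (X :|: Z) (Y :|: Z).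
Proof.
move=> sX sY sZ /andP[/eqP cY /exists_inP[g gG sgXY]].
rewrite /step !card_setU_disjoint // cY addSn eqxx; apply/exists_inP; exists g.
  by rewrite /= product_group -[g]mulg1 mem_mulg.
by rewrite -[g]mulg1 product_act // act1 setSU.
Qed.

Lemma step_setUr X Y Z : X \subset S2 -> Y \subset S2 -> Z \subset S1 ->
  step G2 X Y -> step G (Z :|: X) (Z :|: Y).
Proof.
move=> sX sY sZ /andP[/eqP cY /exists_inP[g gG sgXY]].
rewrite /step !card_setU_disjoint // cY addnS eqxx; apply/exists_inP; exists g.
  by rewrite /= product_group -[g]mul1g mem_mulg.
by rewrite -[g]mul1g product_act // act1 setUS.
Qed.

Definition decomposable N (s : seq {set T}) : Prop :=
  exists2 cs, all (schain G N) cs & perm_eq (flatten cs) s.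

Lemma decomposable_cat N s t :
  decomposable N s -> decomposable N t -> decomposable N (s ++ t).
Proof.
move=> [cs scs ps] [ct sct pt]; exists (cs ++ ct); first by rewrite all_cat scs.
by rewrite flatten_cat perm_cat.
Qed.

Lemma decomposable_perm N s t : perm_eq s t -> decomposable N s -> decomposable N t.
Proof. by move=> pst [cs scs ps]; exists cs => //; exact: perm_trans ps pst. Qed.

(* The rectangle of a product of two chains is peeled off into nested hooks. *)
Lemma chains_product A B c d :
  all (fun X => X \subset S1) (A :: c) -> all (fun X => X \subset S2) (B :: d) ->
  path (step G1) A c -> path (step G2) B d ->
  decomposable (#|A| + #|last A c| + (#|B| + #|last B d|))
    [seq X :|: Y | X <- A :: c, Y <- B :: d].
Proof.
elim: c A B d => [|A' c IHc] A B d sA sB pA pB.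
  have [sA0 _] := andP sA; have sL := allP sB _ (mem_last B d).
  have [sB0 _] := andP sB.
  exists [:: [seq A :|: Y | Y <- B :: d]]; last by rewrite /= !cats0.
  rewrite /= last_map !card_setU_disjoint // andbT; apply/andP; split; last by lia.
  rewrite path_map; apply: (sub_in_path _ sB pB) => X Y sX sY.
  exact: step_setUr.
(* The outer hook: the whole row of [A], then the rest of the last column. *)
pose K := [seq A :|: Y | Y <- B :: d] ++ [seq X :|: last B d | X <- A' :: c].
have /= /and3P[sA0 sA'0 sc] := sA; have /= /andP[sB0 sd] := sB.
have /= /andP[stA pA'] := pA; have /andP[/eqP cA' _] := stA.
have sL := allP sB _ (mem_last B d).
have sA' : all (fun X => X \subset S1) (A' :: c) by rewrite /= sA'0.
apply: (@decomposable_perm _ (K ++ [seq X :|: Y | X <- A' :: c, Y <- belast B d])).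
  suff: perm_eq (K ++ [seq X :|: Y | X <- A' :: c, Y <- belast B d])
    ([seq A :|: Y | Y <- B :: d] ++ [seq X :|: Y | X <- A' :: c, Y <- B :: d]) by [].
  rewrite perm_sym /K -catA perm_cat2l [X in [seq _ | X0 <- _, Y <- X]]lastI.
  exact: perm_allpairs_rcons.
apply: decomposable_cat.
  exists [:: K]; last by rewrite /= cats0.
  rewrite /K /= andbT last_cat /= cat_path !last_map !path_map /= step_setUl //.
  have lA := allP sA' _ (mem_last A' c).
  rewrite (last_map (fun X => X :|: last B d) c A').
  rewrite (@path_map _ _ (fun X => X :|: last B d) _ A').
  rewrite (card_setU_disjoint sA0 sB0) (card_setU_disjoint lA sL) -andbA.
  apply/and3P; split; last by rewrite addnACA.
    by apply: (sub_in_path _ sB pB) => X Y sX sY; exact: step_setUr.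
  by apply: (sub_in_path _ sA' pA') => X Y sX sY; exact: step_setUl.
(* The remaining rectangle starts one rank higher and ends one rank lower, so its rank sum is
   unchanged. *)
case/lastP: d => [|d L] in sB pB sd sL K *; first by exists [::]; rewrite ?allpairs0r.
rewrite belast_rcons last_rcons; move: pB; rewrite rcons_path => /andP[pB /andP[/eqP cL _]].
have sBd : all (fun X => X \subset S2) (B :: d).
  by move: sB; rewrite -rcons_cons all_rcons => /andP[].
by have := IHc A' B d sA' sBd pA' pB; rewrite cA' cL !addSn !addnS.
Qed.

Lemma sco_on_product : sco_on S1 G1 -> sco_on S2 G2 -> sco_on (S1 :|: S2) G.
Proof.
move=> [cs1 [ch1 sub1 cnt1]] [cs2 [ch2 sub2 cnt2]].
(* Pair every chain of one factor with every chain of the other and decompose each rectangle. *)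
have dec : decomposable #|S1 :|: S2|
    [seq X :|: Y | X <- flatten cs1, Y <- flatten cs2].
  rewrite card_setU_disjoint //.
  elim: cs1 ch1 sub1 {cnt1} => [|c cs1 IH1] /=; first by exists [::].
  move=> /andP[cc ch1] sub1; rewrite allpairs_cat; apply: decomposable_cat; last first.
    by apply: IH1 => // X Xcs; apply: sub1; rewrite mem_cat Xcs orbT.
  have {IH1}subc : all (fun X => X \subset S1) c.
    by apply/allP => X Xc; apply: sub1; rewrite mem_cat Xc.
  elim: cs2 ch2 sub2 {cnt2} => [|d cs2 IH2]; first by exists [::]; rewrite ?allpairs0r.
  rewrite /= => /andP[cd ch2] sub2.
  apply: (@decomposable_perm _ ([seq X :|: Y | X <- c, Y <- d] ++
      [seq X :|: Y | X <- c, Y <- flatten cs2])).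
    rewrite perm_sym; exact: permEl (perm_allpairs_catr _ _ (fun=> d) (fun=> flatten cs2)).
  apply: decomposable_cat; last first.
    by apply: IH2 => // X Xcs; apply: sub2; rewrite mem_cat Xcs orbT.
  have subd : all (fun X => X \subset S2) d.
    by apply/allP => X Xd; apply: sub2; rewrite mem_cat Xd.
  case: c cc subc {IH2 sub1} => // A c /andP[pA /eqP <-] sA.
  case: d cd subd {sub2} => // B d /andP[pB /eqP <-] sB.
  exact: chains_product.
have [cs chs pcs] := dec; exists cs; split=> // [A | A sA].
  rewrite (perm_mem pcs) => /allpairsP[[X Y] [/sub1 sX /sub2 sY ->]].
  exact: setUSS.
rewrite (seq.permP pcs).
have -> : A = (A :&: S1) :|: (A :&: S2) by rewrite -setIUr (setIidPl sA).
have [sA1 sA2] := (subsetIr A S1, subsetIr A S2).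
rewrite -[RHS](muln1 1) -{1}(cnt1 _ sA1) -(cnt2 _ sA2).
apply: count_allpairs => X Y /sub1 sX /sub2 sY /=.
exact: product_orb.
Qed.

End Product.

(** * The trivial group, and assembly over disjoint cycles *)

Lemma mem_setorb1 (T : finType) (A B : {set T}) : (B \in setorb 1%G A) = (B == A).
Proof.
apply/orbP/eqP => [[g /set1P-> ->] | ->]; first exact: act1.
by exists 1%g; rewrite ?set11 ?act1.
Qed.

(** The Boolean lattice grows one point at a time, as a product with a two-element chain. *)
Lemma sco_on_trivial (T : finType) (S : {set T}) : sco_on S 1%G.
Proof.
have [k leSk] := ubnP #|S|; elim: k S leSk => // k IHk S leSk.
have [-> | [x xS]] := set_0Vmem S.
  exists [:: [:: set0]]; split=> [|A|A] /=; rewrite ?cards0 ?inE //.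
    by move/eqP->.
  by rewrite subset0 => /eqP->; rewrite mem_setorb1 eqxx.
have -> : (1 : {group {perm T}})%G = (1 <*> 1)%G by apply: val_inj; rewrite /= joingG1.
rewrite -(setD1K xS); apply: sco_on_product; rewrite ?sub1G //.
- by rewrite disjoints1 !inE eqxx.
- exists [:: [:: set0; [set x]]]; split=> [|A|A] /=.
  + rewrite /step cards0 cards1 !andbT /=; apply/exists_inP; exists 1%g; rewrite ?set11 //.
    by rewrite act1 sub0set.
  + by rewrite !inE => /orP[]/eqP->; rewrite ?sub0set.
  rewrite subset1 !mem_setorb1 => /orP[]/eqP->; rewrite eqxx; case: eqP => //.
    by move/setP/(_ x); rewrite !inE eqxx.
  by move/setP/(_ x); rewrite !inE eqxx.
by apply: IHk; rewrite (cardsD1 x) xS in leSk.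
Qed.

Section CyclePowers.
Variables (n t : nat) (sigma : 'I_t -> {perm 'I_n}) (r : 'I_t -> int).
Hypotheses (cyc : forall i, is_cycle (sigma i))
  (disj : forall i j, i != j -> [disjoint psupp (sigma i) & psupp (sigma j)]).
Local Notation z i := (zpow (sigma i) (r i)).

Lemma zpow_cycle i : z i \in <[sigma i]>%g.
Proof. by case: (r i) => k /=; rewrite ?groupV mem_cycle. Qed.

Lemma cycle_Sym i : <[sigma i]>%g \subset Sym (psupp (sigma i)).
Proof. by rewrite cycle_subG !inE; apply/subsetP => x; rewrite !inE. Qed.

(** Induction over a list of indices adds one cycle at a time as a product factor; the bound by
    [Sym] is what [sco_on_product] requires. *)
Lemma sco_on_powers (l : seq 'I_t) : uniq l -> exists H : {group {perm 'I_n}},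
  [/\ H :=: <<[set z i | i in l]>>%g, H \subset Sym (\bigcup_(i <- l) psupp (sigma i))
    & sco_on (\bigcup_(i <- l) psupp (sigma i)) H].
Proof.
elim: l => [_ | i l IHl /= /andP[il /IHl[H [genH symH scoH]]]].
  exists 1%G; rewrite big_nil sub1G; split=> //; last exact: sco_on_trivial.
  rewrite (_ : [set z i | i in [::]] = set0) ?gen0 //.
  by apply/setP => g; rewrite inE; apply/imsetP => -[].
have sz : <[z i]>%g \subset <[sigma i]>%g by rewrite cycle_subG zpow_cycle.
have symz := subset_trans sz (cycle_Sym i).
have dil : [disjoint psupp (sigma i) & \bigcup_(j <- l) psupp (sigma j)].
  rewrite big_seq; elim/big_rec: _ => [|j X jl]; rewrite !disjoints_subset ?setC0 ?subsetT //.
  rewrite setCU subsetI => ->; rewrite andbT -disjoints_subset disj //.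
  by apply: contraNneq il => ->.
exists (<[z i]> <*> H)%G; rewrite big_cons; split.
- rewrite /= genH joing_idr joing_idl; congr <<_>>%g; apply/setP => g.
  rewrite in_setU1; apply/predU1P/imsetP => [[-> | /imsetP[j jl ->]] | [j + ->]].
  + by exists i; rewrite ?inE ?eqxx.
  + by exists j; rewrite // inE jl orbT.
  + by rewrite inE => /predU1P[-> | jl]; [left | right; exact: imset_f].
- have monoSym (A B : {set 'I_n}) : A \subset B -> Sym A \subset Sym B.
    by move=> sAB; apply/subsetP => g; rewrite !inE => sgA; exact: subset_trans sgA sAB.
  rewrite join_subG (subset_trans symz) ?(subset_trans symH) ?monoSym ?subsetUl ?subsetUr //.
apply: sco_on_product => //.
(* The support of a cycle is a single orbit of it. *)
by have [x [_ ->]] := cyc i; exact: sco_on_cycle.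
Qed.

End CyclePowers.

Theorem theorem2p1 (n : nat) (hn : (1 <= n)%N) (t : nat)
  (sigma : 'I_t -> {perm 'I_n}) (r : 'I_t -> int)
  (G : {group {perm 'I_n}}) :
  (forall i, is_cycle (sigma i)) ->
  (forall i j, i != j -> [disjoint psupp (sigma i) & psupp (sigma j)]) ->
  G :=: <<[set zpow (sigma i) (r i) | i : 'I_t]>>%g ->
  quotient_SCO G.
Proof.
move=> cyc disj genG; apply: sco_on_quotient.
have [H [genH symH scoH]] := sco_on_powers r cyc disj (enum_uniq 'I_t).
have -> : G = (H <*> 1)%G.
  apply: val_inj; rewrite /= joingG1 genH genG; congr <<_>>%g.
  by apply/setP => g; apply/imsetP/imsetP => -[i _ ->]; exists i; rewrite ?mem_enum.
(* The points outside all cycles form a last factor, with trivial group. *)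
rewrite -(setUCr (\bigcup_(i <- enum 'I_t) psupp (sigma i))).
apply: sco_on_product => //; last exact: sco_on_trivial.
- by rewrite disjoints_subset setCK.
- exact: sub1G.
Qed.
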